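(* Let $p_1,p_2,\ldots\in[0,1]$ and let $F_i(N)$ and $Q_i$ be the probabilities defined in the context. For every integer $i\ge 2$, $$F_i(N)=(1-p_i)\sum_{l=1}^{N-1}F_{i-1}(l)\,F_{i-1}(N-l)\qquad\text{for every integer } N>1,$$ and $$F_i(1)=p_i\left[Q_{i-1}^2+2^{i-1}\prod_{j=1}^{i-1}\left[(1-p_j)Q_j\right]\right].$$
   Context: $T_i$ is the perfect binary tree with $i$ layers, numbered from the leaves (layer $1$) to the root (layer $i$). Its $2^{i-1}$ leaves carry the data fragments (binary vectors of a fixed length), and every non-leaf vertex carries the bitwise XOR of its two children's fragments. A subset of the vertices is decodable if the fragments at its vertices determine all data fragments (equivalently, the $\mathbb{F}_2$-indicator vectors of the leaf sets below its vertices span $\mathbb{F}_2^{2^{i-1}}$). Vertices in the subset are called present. Random model: each vertex of layer $j$ is present with probability $p_j$, independently of all other vertices. Definitions: $Q_i$ is the probability that the random subset of $T_i$ is decodable. $F_i(N)$ is the probability that the random subset of $T_i$ is decodable and has exactly $N$ present vertices with no present (proper) ancestors. *)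

(* Defs.v *)
From HB Require Import structures.
From mathcomp Require Import all_boot all_order all_algebra.

Set Implicit Arguments.
Unset Strict Implicit.
Unset Printing Implicit Defensive.

Import Order.TTheory GRing.Theory Num.Theory.
Local Open Scope ring_scope.

(* The vertices of the perfect binary tree T_i with i layers: [None] is the
   root and [Some (b, v)] is the vertex v of the b-th of the two copies of
   T_(i-1) hanging from the root; T_0 is empty. *)
Fixpoint vertex (i : nat) : finType :=
  if i is k.+1 then (option (bool * vertex k))%type : finType
  else void : finType.

(* Layers are counted from the leaves (layer 1) to the root (layer i). *)
Fixpoint layer (i : nat) : vertex i -> nat :=
  if i is k.+1 return vertex i -> nat then
    fun v => if v is Some (_, v') then layer v' else k.+1
  else fun=> 0%N.

(* [ancestor u v]: u is a proper ancestor of v. *)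
Fixpoint ancestor (i : nat) : rel (vertex i) :=
  if i is k.+1 return rel (vertex i) then
    fun u v =>
      match u, v with
      | None, Some _ => true
      | Some (b, u'), Some (c, v') => (b == c) && ancestor u' v'
      | _, None => false
      end
  else fun _ _ => false.

Definition child (i : nat) (v w : vertex i) : bool :=
  ancestor v w && (layer v == (layer w).+1).

(* Binary vectors of length L; bitwise XOR is their addition. *)
Notation fragment L := 'rV['F_2]_L.

(* The possible contents of the tree: the fragments at the leaves (the data)
   are arbitrary, and every other vertex carries the XOR of its children. *)
Definition encoded (L i : nat) (c : {ffun vertex i -> fragment L}) : bool :=
  [forall v, (1 < layer v)%N ==> (c v == \sum_(w | child v w) c w)].

Definition decodable (L i : nat) (S : {set vertex i}) : bool :=
  [forall c : {ffun vertex i -> fragment L},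
   forall c' : {ffun vertex i -> fragment L},
     [&& encoded c, encoded c' & [forall v in S, c v == c' v]] ==>
     [forall v, (layer v == 1%N) ==> (c v == c' v)]].

(* The number of present vertices with no present proper ancestor. *)
Definition ntop (i : nat) (S : {set vertex i}) : nat :=
  #|[set v in S | [forall u in S, ~~ ancestor u v]]|.

(* The law of the random set of present vertices: a vertex of layer j is
   present with probability p j, independently of the others. *)
Definition weight (R : realFieldType) (p : nat -> R) (i : nat)
    (S : {set vertex i}) : R :=
  \prod_(v : vertex i) (if v \in S then p (layer v) else 1 - p (layer v)).

Definition Prob (R : realFieldType) (p : nat -> R) (i : nat)
    (E : pred {set vertex i}) : R :=
  \sum_(S : {set vertex i} | E S) weight p S.

Definition Q (R : realFieldType) (L : nat) (p : nat -> R) (i : nat) : R :=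
  Prob p (fun S : {set vertex i} => decodable L S).

Definition F (R : realFieldType) (L : nat) (p : nat -> R) (i N : nat) : R :=
  Prob p (fun S : {set vertex i} => decodable L S && (ntop S == N)).

(* Main.v *)
(* Call a random set on a subtree deficient if it is not decodable but becomes
   so once the root is added.  If the root of T_(k+1) is absent, a set is
   decodable iff its two halves are.  If the root is present, it is decodable
   iff one half is decodable and the other is decodable or deficient: two
   deficient halves leave an undetected word, whose two root values cancel.
   A deficient set of T_(k+1) therefore lacks the root and has one decodable
   and one deficient half, so the probability of deficiency in T_i is
   2^(i-1) (1 - p_i) prod_(j < i) (1 - p_j) Q_j. *)
Require Import Defs.
From HB Require Import structures.
From mathcomp Require Import all_boot all_order all_algebra.
From mathcomp Require Import ring zify.

Set Implicit Arguments.
Unset Strict Implicit.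
Unset Printing Implicit Defensive.

Import Order.TTheory GRing.Theory Num.Theory.
Local Open Scope ring_scope.

(** * Splitting big operators and the child relation at the root *)

Section BigVertex.
Variables (R : Type) (idx : R) (op : Monoid.com_law idx).

Lemma big_vertexS (k : nat) (P : pred (vertex k.+1)) (f : vertex k.+1 -> R) :
  \big[op/idx]_(v | P v) f v =
  op (if P None then f None else idx)
     (op (\big[op/idx]_(v | P (Some (true, v))) f (Some (true, v)))
         (\big[op/idx]_(v | P (Some (false, v))) f (Some (false, v)))).
Proof.
rewrite big_mkcond (bigD1 (None : vertex k.+1)) //=; congr (op _ _).
rewrite (reindex_omap Some id) /=; last by case.
rewrite (eq_bigl xpredT) => [|x]; last by rewrite eqxx.
rewrite (big_mkcond (fun v => P (Some (true, v)))) (big_mkcond (fun v => P (Some (false, v)))) /=.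
(* Moving the guard from the index into the term leaves a full iteration over [bool * vertex k],
   which splits by branch. *)
pose G b v := if P (Some (b, v)) then f (Some (b, v)) else idx.
rewrite -(big_bool op (fun b => \big[op/idx]_v G b v)) pair_bigA.
by apply: eq_bigr => -[].
Qed.
End BigVertex.

Lemma layer_le (k : nat) (v : vertex k) : (layer v <= k)%N.
Proof. by elim: k v => [[]|k IHk [[b v]|]] //=; apply/leqW/IHk. Qed.

Lemma child_root (k : nat) (b : bool) (v : vertex k.+1) :
  child (None : vertex k.+2) (Some (b, v)) = (v == None).
Proof.
case: v => [[c v]|]; rewrite /child //= ?eqxx //.
by rewrite eqSS gtn_eqF // ltnS layer_le.
Qed.

Lemma child_Some (k : nat) (b c : bool) (v w : vertex k) :
  child (Some (b, v) : vertex k.+1) (Some (c, w)) = (b == c) && child v w.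
Proof. by rewrite /child /= andbA. Qed.

(** * Encoded words, and decodability as a trivial kernel *)

Section Codeword.
Variable L : nat.

Definition codeword (i : nat) (c : vertex i -> fragment L) : Prop :=
  forall v, (1 < layer v)%N -> c v = \sum_(w | child v w) c w.

Lemma encodedP (i : nat) (c : {ffun vertex i -> fragment L}) :
  reflect (codeword c) (encoded c).
Proof.
apply: (iffP forallP) => h v; first by move/(implyP (h v))/eqP.
by apply/implyP => /h/eqP.
Qed.

Lemma sum_child_Some (k : nat) (c : vertex k.+1 -> fragment L) (b : bool) (v : vertex k) :
  \sum_(w | child (Some (b, v) : vertex k.+1) w) c w =
  \sum_(w | child v w) c (Some (b, w)).
Proof.
rewrite big_vertexS /= add0r.
by case: b => /=; rewrite !(eq_bigl _ _ (child_Some _ _ _)) /= !big_pred0_eq ?addr0 ?add0r.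
Qed.

Lemma codeword_sub (k : nat) (c : vertex k.+1 -> fragment L) (b : bool) :
  codeword c -> codeword (fun v => c (Some (b, v))).
Proof. by move=> hc v /(hc (Some (b, v))) ->; rewrite sum_child_Some. Qed.

(** Children of a non-root vertex stay in its half, so the root adds exactly one equation. In [T_1]
    the root is a leaf and carries no equation, hence [k.+2]. *)
Lemma codewordS (k : nat) (c : vertex k.+2 -> fragment L) :
  codeword c <->
  (forall b, codeword (fun v : vertex k.+1 => c (Some (b, v)))) /\
  c None = c (Some (true, None)) + c (Some (false, None)).
Proof.
have rootE : \sum_(w | child (None : vertex k.+2) w) c w =
    c (Some (true, None)) + c (Some (false, None)).
  rewrite big_vertexS /= add0r.
  by rewrite !(eq_bigl _ _ (child_root _)) !big_pred1_eq.
split=> [hc | [hc hroot]].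
  by split=> [b|]; [exact: (codeword_sub b hc) | rewrite (hc None)].
case=> [[b v]|] hv; last by rewrite rootE.
by rewrite (hc b v hv) sum_child_Some.
Qed.

Lemma codeword0 (k : nat) (c : vertex k -> fragment L) :
  codeword c -> (forall v, layer v = 1%N -> c v = 0) -> forall v, c v = 0.
Proof.
elim: k c => [|[|k] IHk] c hc c0 //.
  by case=> [[b []]|]; apply: c0.
have sub0 b v : c (Some (b, v)) = 0.
  exact: (IHk _ (codeword_sub b hc) (fun v => c0 (Some (b, v)))).
case=> [[b v]|]; first exact: sub0.
by have [_ ->] := (codewordS c).1 hc; rewrite !sub0 addr0.
Qed.

Lemma codewordB (k : nat) (c c' : vertex k -> fragment L) :
  codeword c -> codeword c' -> codeword (fun v => c v - c' v).
Proof. by move=> h h' v hv; rewrite h // h' // sumrB. Qed.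

(** Encoding is linear, so two words agreeing on [S] differ by a word vanishing on [S]. By
    [codeword0], being zero at the leaves is the same as being zero everywhere. *)
Lemma decodableP (k : nat) (S : {set vertex k}) :
  reflect (forall c : vertex k -> fragment L, codeword c ->
             (forall v, v \in S -> c v = 0) -> forall v, c v = 0)
          (decodable L S).
Proof.
apply: (iffP forallP) => [h c hc c0 | h c].
  apply: codeword0 => // v hv.
  have /implyP := forallP (h [ffun v => c v]) [ffun=> 0].
  have -> /= : encoded [ffun v => c v].
    by apply/encodedP => w; rewrite ffunE => /hc ->; apply: eq_bigr => u _; rewrite ffunE.
  have -> /= : @encoded L k [ffun=> 0].
    by apply/encodedP => w _; rewrite ffunE big1 // => u _; rewrite ffunE.
  have -> /= : [forall u in S, [ffun v => c v] u == [ffun=> 0] u].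
    by apply/forall_inP => u uS; rewrite !ffunE c0.
  by move=> /(_ isT)/forallP/(_ v); rewrite hv eqxx /= !ffunE => /eqP.
apply/forallP => c'; apply/implyP => /and3P[/encodedP hc /encodedP hc' /forall_inP e].
apply/forallP => v; apply/implyP => _; rewrite -subr_eq0; apply/eqP.
by apply: (h (fun v => c v - c' v)) => [|u /e/eqP ->]; [exact: codewordB | exact: subrr].
Qed.

(** Matrix multiplication distributes over the XOR sums; this lets a nonzero root value be moved to
    any prescribed fragment. *)
Lemma codeword_mulmx (k : nat) (c : vertex k -> fragment L) (M : 'M['F_2]_L) :
  codeword c -> codeword (fun v => c v *m M).
Proof. by move=> hc v hv; rewrite hc // mulmx_suml. Qed.

Definition glue (k : nat) (c c' : vertex k.+1 -> fragment L) (v : vertex k.+2) :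
    fragment L :=
  match v : option (bool * vertex k.+1) with
  | Some (b, w) => if b then c w else c' w
  | None => c None + c' None
  end.

Lemma codeword_glue (k : nat) (c c' : vertex k.+1 -> fragment L) :
  codeword c -> codeword c' -> codeword (glue c c').
Proof. by move=> hc hc'; apply/codewordS; split=> // -[]. Qed.

Lemma codeword_zero (k : nat) : codeword (fun _ : vertex k => 0 : fragment L).
Proof. by move=> v _; rewrite big1. Qed.

End Codeword.

(** * Vertex sets as a root bit and two halves *)

Definition join (k : nat) (r : bool) (A B : {set vertex k}) : {set vertex k.+1} :=
  [set v : option (bool * vertex k) |
    if v is Some (b, w) then w \in (if b then A else B) else r].

Definition with_root (k : nat) (S : {set vertex k.+1}) : {set vertex k.+1} :=
  (None : vertex k.+1) |: S.

Definition branch (k : nat) (b : bool) (S : {set vertex k.+1}) : {set vertex k} :=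
  [set v | Some (b, v) \in S].

Lemma in_join_None (k : nat) (r : bool) (A B : {set vertex k}) :
  (None \in join r A B) = r.
Proof. by rewrite inE. Qed.

Lemma in_join_Some (k : nat) (r b : bool) (A B : {set vertex k}) (v : vertex k) :
  (Some (b, v) \in join r A B) = (v \in (if b then A else B)).
Proof. by rewrite inE. Qed.

Lemma forall_in_join (k : nat) (r : bool) (A B : {set vertex k})
    (P : vertex k.+1 -> Prop) :
  (forall v, v \in join r A B -> P v) <->
  [/\ r -> P None, forall v, v \in A -> P (Some (true, v)) &
      forall v, v \in B -> P (Some (false, v))].
Proof.
split=> [h | [hr hA hB] [[[] v]|]]; last 3 first.
- by rewrite in_join_Some; apply: hA.
- by rewrite in_join_Some; apply: hB.
- by rewrite in_join_None; apply: hr.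
by split=> [hr | v hv | v hv]; apply: h; rewrite ?in_join_None ?in_join_Some.
Qed.

Lemma join_branch (k : nat) (S : {set vertex k.+1}) :
  join (None \in S) (branch true S) (branch false S) = S.
Proof.
apply/setP => -[[b v]|]; last by rewrite in_join_None.
by rewrite in_join_Some; case: b; rewrite inE.
Qed.

Lemma branch_join (k : nat) (r b : bool) (A B : {set vertex k}) :
  branch b (join r A B) = if b then A else B.
Proof. by apply/setP => v; rewrite inE in_join_Some. Qed.

Lemma with_root_join (k : nat) (r : bool) (A B : {set vertex k}) :
  with_root (join r A B) = join true A B.
Proof.
by apply/setP => -[[b v]|]; rewrite in_setU1 ?in_join_None ?in_join_Some.
Qed.

(** * Decodability in terms of the two halves *)

Section Decodable.
Variable L : nat.

Lemma decodableS (k : nat) (S T : {set vertex k}) :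
  S \subset T -> decodable L S -> decodable L T.
Proof.
move=> /subsetP sST /decodableP h; apply/decodableP => c hc c0.
by apply: h => // v /sST; apply: c0.
Qed.

Lemma decodable_vertex1 (r : bool) (A B : {set vertex 0}) : (0 < L)%N ->
  decodable L (join r A B) = r.
Proof.
move=> hL; apply/decodableP/idP => [h | hr c _ /forall_in_join[/(_ hr) c0 _ _]].
  apply: contraT => hr.
  (* The all-ones word vanishes on the empty set, yet is nonzero because [L] is positive. *)
  have: const_mx 1 = 0 :> fragment L.
    apply: (h (fun=> const_mx 1) _ _ None) => [[[b []]|] //|].
    by apply/forall_in_join; split=> [|[]|[]]; rewrite // (negbTE hr).
  by move/matrixP/(_ ord0 (Ordinal hL)); rewrite !mxE.
by case=> [[b []]|].
Qed.

(** An absent root imposes nothing, so a kernel word of one half extends by zero on the other;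
    conversely, two zero halves force a zero root. *)
Lemma decodable_join_false (k : nat) (A B : {set vertex k.+1}) :
  decodable L (join false A B) = decodable L A && decodable L B.
Proof.
apply/decodableP/andP => [h | [/decodableP hA /decodableP hB] c hc c0].
  split; apply/decodableP => c hc c0 v.
    apply: (h (glue c (fun=> 0)) _ _ (Some (true, v))).
      exact: codeword_glue (@codeword_zero _ _).
    by apply/forall_in_join.
  apply: (h (glue (fun=> 0) c) _ _ (Some (false, v))).
    exact: codeword_glue (@codeword_zero _ _) _.
  by apply/forall_in_join.
have [_ c0A c0B] := (forall_in_join _ _ _ _).1 c0.
have cA := hA _ (codeword_sub true hc) c0A.
have cB := hB _ (codeword_sub false hc) c0B.
have [_ cN] := (codewordS c).1 hc.
by case=> [[[] v]|] //; rewrite cN cA cB addr0.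
Qed.

(* If both kernels contain a word that is nonzero at its root, the two root
   values can be made opposite by a linear map acting on all fragments, and
   gluing gives a nonzero word vanishing on the whole of [join true A B]. *)
Lemma decodable_join_true (k : nat) (A B : {set vertex k.+1}) :
  decodable L (join true A B) =
  decodable L A && decodable L (with_root B) ||
  decodable L (with_root A) && decodable L B.
Proof.
apply/idP/idP => [/decodableP h | ].
  have hA : decodable L (with_root A).
    apply/decodableP => c hc c0 v.
    apply: (h (glue c (fun=> 0)) _ _ (Some (true, v))).
      exact: codeword_glue (@codeword_zero _ _).
    (* The glued root value is [c None], which is zero because [with_root A] contains the root. *)
    apply/forall_in_join; split=> //= [_ | w hw]; first by rewrite c0 ?addr0 ?add0r ?setU11.
    by apply: c0; rewrite in_setU1 hw orbT.
  have hB : decodable L (with_root B).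
    apply/decodableP => c hc c0 v.
    apply: (h (glue (fun=> 0) c) _ _ (Some (false, v))).
      exact: codeword_glue (@codeword_zero _ _) _.
    apply/forall_in_join; split=> //= [_ | w hw]; first by rewrite c0 ?addr0 ?add0r ?setU11.
    by apply: c0; rewrite in_setU1 hw orbT.
  rewrite hA hB andbT /=; apply/orP.
  case: (boolP (decodable L A)) => nA; [by left | right].
  apply/decodableP => cB hcB cB0.
  have [cBN | cBN] := eqVneq (cB None) 0.
    move/decodableP: hB; apply=> // v; rewrite in_setU1 => /orP[/eqP -> //|].
    exact: cB0.
  case/negP: nA; apply/decodableP => cA hcA cA0.
  have [cAN | cAN] := eqVneq (cA None) 0.
    move/decodableP: hA; apply=> // v; rewrite in_setU1 => /orP[/eqP -> //|].
    exact: cA0.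
  (* A nonzero row is row-free, so [pinvmx] is its right inverse and [M] sends [cA None] to
     [- cB None]. *)
  pose M := pinvmx (cA None) *m - cB None.
  have MN : cA None *m M = - cB None.
    by rewrite mulmxA mulmxVp ?mul1mx // /row_free rank_rV cAN.
  have := h _ (codeword_glue (codeword_mulmx M hcA) hcB) _ (Some (false, None)).
  case/(_ _)/eqP/idPn => //.
  apply/forall_in_join; split=> [_ | w hw | //] /=; first by rewrite MN addNr.
  by rewrite cA0 ?mul0mx.
(* A zero root makes the two half-roots cancel; the decodable half is zero at its root, hence so is
   the other. *)
case/orP=> /andP[/decodableP hA /decodableP hB];
  apply/decodableP => c hc /forall_in_join[/(_ isT) c0N c0A c0B];
  have [_] := (codewordS c).1 hc; rewrite c0N => cN.
- have cA := hA _ (codeword_sub true hc) c0A.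
  have cB : forall v, c (Some (false, v)) = 0.
    apply: hB (codeword_sub false hc) _ => v /setU1P[-> | /c0B //].
    by rewrite cA add0r in cN.
  by case=> [[[] v]|].
- have cB := hB _ (codeword_sub false hc) c0B.
  have cA : forall v, c (Some (true, v)) = 0.
    apply: hA (codeword_sub true hc) _ => v /setU1P[-> | /c0A //].
    by rewrite cB addr0 in cN.
  by case=> [[[] v]|].
Qed.

End Decodable.

(** * Counting the topmost present vertices *)

Lemma ntop_join_true (k : nat) (A B : {set vertex k}) : ntop (join true A B) = 1%N.
Proof.
rewrite /ntop -(cards1 (None : vertex k.+1)); apply: eq_card => v.
rewrite !inE; case: v => [[b v]|] /=; last by apply/forall_inP => -[[]|].
apply/negbTE; rewrite negb_and orbC; apply/orP; left.
by rewrite negb_forall_in; apply/exists_inP; exists None => //; rewrite in_join_None.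
Qed.

Lemma ntop_join_false (k : nat) (A B : {set vertex k}) :
  ntop (join false A B) = (ntop A + ntop B)%N.
Proof.
rewrite /ntop -!sum1_card big_vertexS !inE /= add0n.
congr (_ + _)%N; apply: eq_bigl => v; rewrite !inE; congr (_ && _).
  apply/forall_inP/forall_inP => h u hu.
    by have := h (Some (true, u)); rewrite in_join_Some; apply.
  case: u hu => [[[] u]|]; rewrite ?in_join_None ?in_join_Some //=; exact: h.
apply/forall_inP/forall_inP => h u hu.
  by have := h (Some (false, u)); rewrite in_join_Some; apply.
case: u hu => [[[] u]|]; rewrite ?in_join_None ?in_join_Some //=; exact: h.
Qed.

(** A present root is itself topmost; without it, the decodable [true] half supplies a top vertex by
    induction. With [L] zero the empty set would be decodable. *)
Lemma ntop_gt0 (L k : nat) (S : {set vertex k.+1}) : (0 < L)%N ->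
  decodable L S -> (0 < ntop S)%N.
Proof.
move=> hL; elim: k S => [|k IHk] S; rewrite -[S]join_branch;
  case: (None \in S); rewrite ?ntop_join_true //.
  by rewrite decodable_vertex1.
by rewrite decodable_join_false ntop_join_false => /andP[/IHk hA _]; rewrite addn_gt0 hA.
Qed.

(** * The product law of the root and the two halves *)

Section Probability.
Variables (R : realFieldType) (p : nat -> R).

Lemma weight_join (k : nat) (r : bool) (A B : {set vertex k}) :
  weight p (join r A B) =
  (if r then p k.+1 else 1 - p k.+1) * (weight p A * weight p B).
Proof.
rewrite /weight big_vertexS /= in_join_None; congr (_ * (_ * _));
  by apply: eq_bigr => v _; rewrite in_join_Some.
Qed.

(** The joint law of the two halves, which are independent; [E] may be any event on pairs, not only
    a product event. *)
Definition Prob2 (k : nat) (E : {set vertex k} -> {set vertex k} -> bool) : R :=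
  \sum_(AB : {set vertex k} * {set vertex k} | E AB.1 AB.2)
    weight p AB.1 * weight p AB.2.

Lemma eq_Prob2 (k : nat) (E E' : {set vertex k} -> {set vertex k} -> bool) :
  (forall A B, E A B = E' A B) -> Prob2 E = Prob2 E'.
Proof. by move=> h; apply: eq_bigl => AB. Qed.

Lemma Prob2_eq0 (k : nat) (E : {set vertex k} -> {set vertex k} -> bool) :
  (forall A B, ~~ E A B) -> Prob2 E = 0.
Proof. by move=> h; apply: big_pred0 => AB; apply/negbTE. Qed.

Lemma Prob2U (k : nat) (E E' : {set vertex k} -> {set vertex k} -> bool) :
  (forall A B, ~~ (E A B && E' A B)) ->
  Prob2 (fun A B => E A B || E' A B) = Prob2 E + Prob2 E'.
Proof.
move=> h; rewrite /Prob2 big_mkcond [X in X + _]big_mkcond [X in _ + X]big_mkcond.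
rewrite -big_split /=; apply: eq_bigr => AB _; move: (h AB.1 AB.2).
by case: (E _ _); case: (E' _ _) => //=; rewrite ?addr0 ?add0r.
Qed.

Lemma Prob2M (k : nat) (E E' : pred {set vertex k}) :
  Prob2 (fun A B => E A && E' B) = Prob p E * Prob p E'.
Proof. by rewrite /Prob big_distrlr /= pair_big. Qed.

Lemma Prob_join (k : nat) (E : pred {set vertex k.+1}) :
  Prob p E = p k.+1 * Prob2 (fun A B => E (join true A B)) +
             (1 - p k.+1) * Prob2 (fun A B => E (join false A B)).
Proof.
pose f (t : bool * ({set vertex k} * {set vertex k})) := join t.1 t.2.1 t.2.2.
have f_bij : bijective f.
  exists (fun S : {set vertex k.+1} => (None \in S, (branch true S, branch false S)))
    => [[r [A B]]|S].
    by rewrite /f /= in_join_None !branch_join.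
  exact: join_branch.
rewrite /Prob (reindex f (onW_bij _ f_bij)) /= big_mkcond /=.
have := pair_bigA +%R (fun r AB => if E (f (r, AB)) then weight p (f (r, AB)) else 0).
rewrite big_bool /= => e; transitivity
  (\sum_t (if E (f (t.1, t.2)) then weight p (f (t.1, t.2)) else 0)).
  by apply: eq_bigr => -[r AB].
rewrite -e -!big_mkcond /Prob2 !mulr_sumr /=.
by congr (_ + _); apply: eq_bigr => AB _; rewrite weight_join.
Qed.

Lemma Prob_vertex0 : Prob p (fun _ : {set vertex 0} => true) = 1.
Proof.
rewrite /Prob (big_pred1 set0) => [|S]; first by rewrite /weight big1 // => -[].
by apply/esym/eqP/setP => -[].
Qed.

(** A convolution: pairs are grouped by [l = f A], and positivity of both counts confines [l] to the
    range from 1 to [N - 1]. *)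
Lemma Prob2_sum (k N : nat) (E E' : pred {set vertex k}) (f : {set vertex k} -> nat) :
  (forall A, E A -> (0 < f A)%N) -> (forall A, E' A -> (0 < f A)%N) ->
  Prob2 (fun A B => E A && E' B && (f A + f B == N)%N) =
  \sum_(1 <= l < N) Prob p (fun A => E A && (f A == l)) *
                    Prob p (fun B => E' B && (f B == N - l)%N).
Proof.
move=> fE fE'; under [RHS]eq_bigr do rewrite -Prob2M /Prob2 big_mkcond.
rewrite exchange_big /= /Prob2 big_mkcond; apply: eq_bigr => -[A B] _ /=.
have [EA | _] := boolP (E A); last by rewrite big1.
have [EB | _] := boolP (E' B); last first.
  by rewrite big1 // => l _; rewrite andbF.
have fA := fE _ EA; have fB := fE' _ EB; rewrite /=.
rewrite (eq_bigr (fun l => if l == f A then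
   (if (f B == N - f A)%N then weight p A * weight p B else 0) else 0)); last first.
  by move=> l _; rewrite eq_sym; case: eqP => // ->.
rewrite -big_mkcond big_nat1_eq fA /=.
(* Positivity of [f B] gives [f A < N], and then the truncated subtraction is exact. *)
have -> : (f A + f B == N)%N = (f A < N)%N && (f B == N - f A)%N by lia.
by rewrite if_and.
Qed.

End Probability.

(** * The probability of deficiency *)

Definition Prob_deficient (R : realFieldType) (L : nat) (p : nat -> R) (i : nat) : R :=
  if i is k.+1 then
    Prob p (fun S : {set vertex k.+1} => decodable L (with_root S) && ~~ decodable L S)
  else 0.

Section Recurrences.
Variables (R : realFieldType) (p : nat -> R) (L k : nat).

Let D (A : {set vertex k.+1}) := decodable L A.
Let D' (A : {set vertex k.+1}) := decodable L (with_root A) && ~~ decodable L A.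

(** By monotonicity, decodable after adding the root means decodable or deficient; the criterion
    thus becomes a union of mutually exclusive product events. *)
Lemma decodable_root_cases (A B : {set vertex k.+1}) :
  decodable L (join true A B) =
  (D A && D B) || ((D A && D' B) || (D' A && D B)).
Proof.
rewrite decodable_join_true /D /D'.
have /implyP := @decodableS L _ A (with_root A) (subsetUr _ _).
have /implyP := @decodableS L _ B (with_root B) (subsetUr _ _).
by do 4!case: (decodable _ _).
Qed.

Lemma Prob2_one_deficient :
  Prob2 p (fun A B => (D A && D' B) || (D' A && D B)) =
  2 * (Q L p k.+1 * Prob_deficient L p k.+1).
Proof.
rewrite Prob2U ?Prob2M.
  by rewrite -/(Q L p k.+1) -/(Prob_deficient L p k.+1); ring.
by move=> A B; rewrite /D /D'; case: (decodable L A); rewrite /= ?andbF.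
Qed.

(** Adding a root already present changes nothing, so a deficient set lacks it; striking the case of
    two decodable halves leaves exactly one deficient half. *)
Lemma Prob_deficientS :
  Prob_deficient L p k.+2 =
  (1 - p k.+2) * (2 * (Q L p k.+1 * Prob_deficient L p k.+1)).
Proof.
rewrite [LHS]Prob_join Prob2_eq0 => [|A B]; last by rewrite with_root_join andbN.
rewrite mulr0 add0r -Prob2_one_deficient; congr (_ * _); apply: eq_Prob2 => A B.
rewrite with_root_join decodable_root_cases decodable_join_false /D /D'.
by case: (decodable L A); case: (decodable L B); rewrite /= ?andbF ?orbF ?andbT.
Qed.

End Recurrences.

(** Each further layer gives a factor 2 for the choice of the deficient half. The recursion starts
    at [T_1], where deficiency means that the only vertex is absent. *)
Lemma Prob_deficientE (R : realFieldType) (p : nat -> R) (L k : nat) : (0 < L)%N ->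
  Prob_deficient L p k.+1 =
  2 ^+ k * (1 - p k.+1) * \prod_(1 <= j < k.+1) ((1 - p j) * Q L p j).
Proof.
move=> hL; elim: k => [|k IHk]; last first.
  by rewrite Prob_deficientS IHk exprS [in RHS]big_nat_recr //=; ring.
rewrite big_geq // [LHS]Prob_join Prob2_eq0 => [|A B]; last by rewrite with_root_join andbN.
rewrite (@eq_Prob2 _ _ _ _ (fun _ _ => true && true)) => [|A B]; last first.
  by rewrite with_root_join !decodable_vertex1.
by rewrite (Prob2M p xpredT xpredT) Prob_vertex0; ring.
Qed.

Theorem lemma21 (R : realFieldType) (L : nat) (hL : (0 < L)%N)
    (p : nat -> R) (hp : forall j : nat, (1 <= j)%N -> 0 <= p j <= 1)
    (i : nat) (hi : (2 <= i)%N) :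
  (forall N : nat, (1 < N)%N ->
     F L p i N =
       (1 - p i) * \sum_(1 <= l < N) F L p i.-1 l * F L p i.-1 (N - l)) /\
  F L p i 1 =
    p i * (Q L p i.-1 ^+ 2
           + 2 ^+ i.-1 * \prod_(1 <= j < i) ((1 - p j) * Q L p j)).
Proof.
case: i hi => [|[|k]] // _; split=> [N hN|]; rewrite [LHS]Prob_join /=.
  (* A present root is the only top vertex, which [N > 1] excludes. *)
  rewrite Prob2_eq0 => [|A B]; last by rewrite ntop_join_true ltn_eqF ?andbF.
  rewrite mulr0 add0r; congr (_ * _).
  rewrite -Prob2_sum; try by move=> A; apply: ntop_gt0.
  by apply: eq_Prob2 => A B; rewrite decodable_join_false ntop_join_false.
(* With the root absent, each half has a top vertex, so the count is at least 2. *)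
rewrite [X in _ + _ * X]Prob2_eq0 => [|A B]; last first.
  rewrite decodable_join_false ntop_join_false; apply/negP => /andP[/andP[]].
  by move=> /(ntop_gt0 hL) hA /(ntop_gt0 hL) hB /eqP; lia.
rewrite mulr0 addr0; congr (_ * _).
under eq_Prob2 do rewrite ntop_join_true andbT decodable_root_cases.
rewrite Prob2U => [|A B]; last first.
  by case: (decodable L A); case: (decodable L B); rewrite /= ?andbF.
(* The choice of the deficient half supplies the last factor 2, and the decodable half the last [Q],
   at [j = k.+1]. *)
rewrite Prob2M Prob2_one_deficient Prob_deficientE //
  -[Prob p _]/(Q L p k.+1) [in RHS]big_nat_recr //= expr2 exprS.
ring.
Qed.
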